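(* Let $1<p<\infty$. Suppose that $f$ is a nonnegative measurable function on $\mathbb{R}^n\times\mathbb{R}^n$ with $\int_{\mathbb{R}^n}\|f(x,\cdot)\|_{L^{p,\infty}(\mathbb{R}^n)}\,dx<\infty$. Then $$\Big\|\int_{\mathbb{R}^n}|f(x,\cdot)|\,dx\Big\|_{L^{p,\infty}(\mathbb{R}^n)}\le C\int_{\mathbb{R}^n}\|f(x,\cdot)\|_{L^{p,\infty}(\mathbb{R}^n)}\,dx,$$ where $C$ is a positive constant independent of $f$.
   Context: $L^{p,\infty}(\mathbb{R}^n)$ is the weak Lebesgue space with $\|g\|_{L^{p,\infty}(\mathbb{R}^n)}=\sup_{\lambda>0}\lambda\,|\{y\in\mathbb{R}^n:|g(y)|>\lambda\}|^{1/p}$. *)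

(* Defs.v *)
From HB Require Import structures.
From mathcomp Require Import all_boot all_order all_algebra.
From mathcomp Require Import all_classical all_reals all_analysis.
From mathcomp Require Import measurable_realfun.

Set Implicit Arguments.
Unset Strict Implicit.
Unset Printing Implicit Defensive.
Import Order.TTheory GRing.Theory Num.Theory.
Import numFieldNormedType.Exports.

Local Open Scope classical_set_scope.
Local Open Scope ring_scope.
Local Open Scope ereal_scope.

(* As a measurableType, [Rn R n] carries the product of the Borel
   sigma-algebras, that is, the Borel sigma-algebra of R^n. *)
Notation Rn R n := (n.-tuple (measurableTypeR R)).

Section borel_lebesgue.
Context {R : realType}.

Definition consRn n (z : measurableTypeR R * Rn R n) : Rn R n.+1 :=
  [tuple of z.1 :: z.2].

Lemma measurable_consRn n : measurable_fun setT (@consRn n).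
Proof. exact: measurable_cons. Qed.

Section successor.
Variables (n : nat) (m : {sigma_finite_measure set (Rn R n) -> \bar R}).

(* The image of (Lebesgue measure on R) x m under R x R^n = R^(n+1). *)
Definition lebesgueS : set (Rn R n.+1) -> \bar R :=
  pushforward (lebesgue_measure \x m) (@consRn n).

Let lebesgueS0 : lebesgueS set0 = 0.
Proof. by rewrite /lebesgueS /pushforward preimage_set0 measure0. Qed.

Let lebesgueS_ge0 A : 0 <= lebesgueS A.
Proof. by rewrite /lebesgueS /pushforward measure_ge0. Qed.

Let lebesgueS_sigma_additive : semi_sigma_additive lebesgueS.
Proof.
move=> F mF tF mUF; rewrite /lebesgueS /pushforward preimage_bigcup.
apply: measure_semi_sigma_additive.
- by move=> k; rewrite -[X in measurable X]setTI; exact: measurable_consRn.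
- apply/trivIsetP => /= i j _ _ ij; rewrite -preimage_setI.
  by move/trivIsetP : tF => /(_ _ _ _ _ ij) ->//; rewrite preimage_set0.
- rewrite -preimage_bigcup -[X in measurable X]setTI.
  exact: measurable_consRn.
Qed.

HB.instance Definition _ := isMeasure.Build _ _ _ lebesgueS
  lebesgueS0 lebesgueS_ge0 lebesgueS_sigma_additive.

Let lebesgueS_sigma_finite : sigma_finite setT lebesgueS.
Proof.
have /sigma_finiteP[F [TF ndF Foo]] := sigma_finiteT (@lebesgue_measure R).
have /sigma_finiteP[G [TG ndG Goo]] := sigma_finiteT m.
pose hd (t : Rn R n.+1) : measurableTypeR R := thead t.
pose tl (t : Rn R n.+1) : Rn R n := [tuple of behead t].
have mhd : measurable_fun setT hd by exact: measurable_tnth.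
have mtl : measurable_fun setT tl by exact: measurable_behead.
exists (fun k => hd @^-1` F k `&` tl @^-1` G k).
  apply/seteqP; split => // t _.
  have [i _ Fi] : (\bigcup_i F i) (hd t) by rewrite -TF.
  have [j _ Gj] : (\bigcup_i G i) (tl t) by rewrite -TG.
  exists (maxn i j) => //; split.
    by have /subsetPset := ndF _ _ (leq_maxl i j); exact.
  by have /subsetPset := ndG _ _ (leq_maxr i j); exact.
move=> k; have [mF Fk] := Foo k; have [mG Gk] := Goo k; split.
  apply: measurableI; rewrite -[X in measurable X]setTI; [exact: mhd|exact: mtl].
rewrite /lebesgueS /pushforward.
rewrite (_ : _ @^-1` _ = F k `*` G k).
  by rewrite product_measure1E// lte_mul_pinfty// ge0_fin_numE.
have hdK z : hd (consRn z) = z.1 by rewrite /hd /consRn theadE.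
have tlK z : tl (consRn z) = z.2 by exact: val_inj.
by apply/seteqP; split => z /=; rewrite hdK tlK.
Qed.

HB.instance Definition _ := Measure_isSigmaFinite.Build _ _ _ lebesgueS
  lebesgueS_sigma_finite.

End successor.

Fixpoint borel_lebesgue (n : nat) :
    {sigma_finite_measure set (Rn R n) -> \bar R} :=
  match n with
  | 0 => \d_([tuple] : Rn R 0)
  | k.+1 => lebesgueS (borel_lebesgue k)
  end.

Lemma borel_lebesgue_box n (A : 'I_n -> set (measurableTypeR R)) :
  (forall i, measurable (A i)) ->
  borel_lebesgue n [set t | forall i, A i (tnth t i)] =
  \prod_(i < n) lebesgue_measure (A i).
Proof.
elim: n A => [|n IHn] A mA.
  by rewrite big_ord0 /= diracE mem_set//= => -[].
have mB i : measurable (A (lift ord0 i)) by exact: mA.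
rewrite big_ord_recl -IHn// /= /lebesgueS /pushforward.
set B := [set t : Rn R n | _].
rewrite (_ : _ @^-1` _ = A ord0 `*` B).
  rewrite product_measure1E//.
  rewrite (_ : B = \bigcap_(i in [set: 'I_n]) (tnth (T:=_) ^~ i) @^-1` A (lift ord0 i)).
    apply: fin_bigcap_measurable => // i _.
    by rewrite -[X in measurable X]setTI; exact: measurable_tnth.
  by apply/seteqP; split => [t Bt i _|t Bt i]; exact: Bt.
apply/seteqP; split => -[x t] /=.
  move=> At; split; first by have := At ord0; rewrite tnth0.
  by move=> i; have := At (lift ord0 i); rewrite tnthS.
move=> [Ax Bt] i; have [->|[j ->]] : i = ord0 \/ exists j, i = lift ord0 j.
  by case: (unliftP ord0 i) => [j ->|->]; [right; exists j|left].
  by rewrite tnth0.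
by rewrite tnthS; exact: Bt.
Qed.

End borel_lebesgue.
Arguments borel_lebesgue : clear implicits.

(* R^n and R^n x R^n with their sigma-algebras of Lebesgue measurable sets,
   i.e. the completions of the Borel sigma-algebras. *)
Notation lebesgue_space R n := (caratheodory_type (borel_lebesgue R n)^*%mu).
Notation lebesgue_space2 R n :=
  (caratheodory_type (borel_lebesgue R n \x borel_lebesgue R n)^*%mu).

Definition Rn_lebesgue (R : realType) (n : nat) :
    set (lebesgue_space R n) -> \bar R :=
  @completed_measure_extension _ _ _ (borel_lebesgue R n).
HB.instance Definition _ (R : realType) (n : nat) :=
  Measure.on (@Rn_lebesgue R n).
Arguments Rn_lebesgue : clear implicits.

Definition weakLnorm d (T : measurableType d) (R : realType)
    (mu : set T -> \bar R) (p : R) (g : T -> \bar R) : \bar R :=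
  ereal_sup [set l%:E * (mu [set y | l%:E < `|g y|]) `^ p^-1
            | l in [set l : R | (0 < l)%R]].

(* Main.v *)
Require Import Defs.
From mathcomp Require Import all_boot all_order all_algebra.
From mathcomp Require Import all_classical all_reals all_analysis.
From mathcomp Require Import measurable_realfun.
From mathcomp Require Import ring.
Import Order.TTheory GRing.Theory Num.Theory.
Local Open Scope classical_set_scope.
Local Open Scope ring_scope.
Local Open Scope ereal_scope.

(** The weak Lebesgue quasi-norm does not satisfy the triangle inequality,
    but for p > 1 it is controlled by averages over sets of finite measure:
    by [weak_holder],

      \int_E h <= C |E|^(1 - 1/p) ||h||_{p,oo},

    because at height t only a part of E of measure at most min(|E|,
    (||h||_{p,oo} / t)^p) contributes, and since p > 1 these contributions
    sum to a finite amount over dyadic heights. The left-hand side is linear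
    in h, so it commutes with integration in x. Let G(y) be the integral of
    g(x, y) in x, and let E be a part of finite measure of {G > l};
    Chebyshev's inequality, Tonelli's theorem and the estimate above give

      l |E| <= \int_E G = \int_x \int_E g(x, .)
            <= C |E|^(1 - 1/p) \int_x ||g(x, .)||_{p,oo}.

    Dividing by |E|^(1 - 1/p) and letting E increase to {G > l} yields the
    inequality for g measurable with respect to the product sigma-algebra,
    over arbitrary sigma-finite measures ([weak_minkowski]).

    A Lebesgue measurable f on R^n x R^n need not be of this kind, and its
    slices may fail to be measurable for a null set of x. It has, however, a
    Borel majorant g which differs from f only on a Borel null set N
    ([measurable_majorant]). Replacing f by g increases the left-hand side.
    It leaves ||f(x, .)||_{p,oo} unchanged for every x such that the slice
    of N at x is null, that is, for almost every x ([negligible_xsection]),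
    so the right-hand side does not increase. *)

Set Implicit Arguments.
Unset Strict Implicit.
Unset Printing Implicit Defensive.

(** * Preliminaries *)

(** The integral of a nonnegative function is a supremum over the simple
    functions below it, hence monotone without measurability. This matters
    for the slices of a function measurable for a completed product, which
    are measurable only almost everywhere. *)
Lemma ge0_le_lower_integral d (T : measurableType d) (R : realType)
    (mu : {measure set T -> \bar R}) (f1 f2 : T -> \bar R) :
  (forall x, 0 <= f1 x) -> (forall x, f1 x <= f2 x) ->
  \int[mu]_x f1 x <= \int[mu]_x f2 x.
Proof.
move=> f10 f12; rewrite !ge0_integralTE//; last first.
  by move=> x; exact: le_trans (f12 x).
apply: ereal_sup_le => _ [h hf1 <-]; exists h => // x.
exact: le_trans (hf1 x) (f12 x).
Qed.

Lemma lee_mul_poweRV (R : realType) (p l w : R) (a : \bar R) :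
  (0 < p)%R -> (0 < l)%R -> (0 <= w)%R -> 0 <= a ->
  (l%:E * a `^ p^-1 <= w%:E) = (a <= ((w / l) `^ p)%:E).
Proof.
move=> p0 l0 w0; case: a => [a a0|_|//]; last first.
  by rewrite poweRyr ?invr_neq0 ?gt_eqF// gt0_muley ?lte_fin// !leye_eq.
rewrite lee_fin in a0; rewrite poweR_EFin -EFinM !lee_fin -ler_pdivlMl// mulrC.
have powK (b q : R) : (0 < q)%R -> (0 <= b)%R -> ((b `^ q) `^ q^-1 = b)%R.
  by move=> q0 b0; rewrite -powRrM divff ?gt_eqF// powRr1.
have wl0 : (0 <= w / l)%R by rewrite divr_ge0// ltW.
apply/idP/idP => h.
  rewrite -[leLHS](powK a p^-1)%R ?invr_gt0// invrK.
  by apply: ge0_ler_powR; rewrite ?nnegrE ?powR_ge0// ltW.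
rewrite -[leRHS](powK _ p)//.
by apply: ge0_ler_powR; rewrite ?nnegrE ?powR_ge0// invr_ge0 ltW.
Qed.

Lemma measurable_fun_lt_levels d (T : measurableType d) (R : realType)
    (f : T -> \bar R) :
  (forall r : R, measurable [set x | r%:E < f x]) -> measurable_fun setT f.
Proof.
move=> mf; apply: (measurability _ (ErealGenOInfty.measurableE R)).
by move=> _ [_ [r ->] <-]; rewrite setTI preimage_itvoy; exact: mf.
Qed.

(** * The weak Lebesgue quasi-norm *)

Section weakLnorm_theory.
Context d (T : measurableType d) (R : realType).
Implicit Types (mu : set T -> \bar R) (g : T -> \bar R) (p : R).

Lemma weakLnorm_ubound mu p g (l : R) : (0 < l)%R ->
  l%:E * (mu [set y | l%:E < `|g y|]) `^ p^-1 <= weakLnorm mu p g.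
Proof. by move=> l0; apply: ereal_sup_ubound; exists l. Qed.

Lemma weakLnorm_ge0 mu p g : 0 <= weakLnorm mu p g.
Proof.
have := weakLnorm_ubound mu p g (@ltr01 R).
by apply: (le_trans _); rewrite mul1e poweR_ge0.
Qed.

End weakLnorm_theory.

Section weakLnorm_comparison.
Context d (T : measurableType d) (R : realType).
Implicit Types (mu : set T -> \bar R) (g : T -> \bar R) (p : R).

Lemma le_weakLnorm d' (T' : measurableType d') (nu : set T' -> \bar R)
    (h : T' -> \bar R) mu g p : (0 < p)%R ->
  (forall l : R, (0 < l)%R -> 0 <= mu [set y | l%:E < `|g y|]) ->
  (forall l : R, (0 < l)%R ->
    mu [set y | l%:E < `|g y|] <= nu [set y | l%:E < `|h y|]) ->
  weakLnorm mu p g <= weakLnorm nu p h.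
Proof.
move=> p0 mu0 munu; apply: ge_ereal_sup => _ [l /= l0 <-].
apply: (le_trans _ (weakLnorm_ubound nu p h l0)).
rewrite lee_pmul2l ?lte_fin//.
have nu0 := le_trans (mu0 l l0) (munu l l0).
apply: gt0_ler_poweR; rewrite ?invr_ge0 ?(ltW p0)//.
- by rewrite in_itv/= mu0// leey.
- by rewrite in_itv/= nu0 leey.
- exact: munu.
Qed.

(** Membership in the ball of radius w, freed of the exponent 1/p. *)
Lemma weakLnorm_leP mu p g (w : R) : (0 < p)%R -> (0 <= w)%R ->
  (forall l : R, (0 < l)%R -> 0 <= mu [set y | l%:E < `|g y|]) ->
  weakLnorm mu p g <= w%:E <->
  (forall l : R, (0 < l)%R ->
    mu [set y | l%:E < `|g y|] <= ((w / l) `^ p)%:E).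
Proof.
move=> p0 w0 mu0; split=> [gw l l0|gw].
  rewrite -lee_mul_poweRV ?mu0//.
  exact: le_trans (weakLnorm_ubound mu p g l0) gw.
by apply: ge_ereal_sup => _ [l /= l0 <-]; rewrite lee_mul_poweRV ?mu0 ?gw.
Qed.

End weakLnorm_comparison.

Section measurable_weakLnorm.
Context d1 d2 (T1 : measurableType d1) (T2 : measurableType d2) (R : realType).
Variable m2 : {sigma_finite_measure set T2 -> \bar R}.

(** The supremum may be restricted to rational levels, since the measure of a
    superlevel set decreases with the level. *)
Lemma measurable_weakLnorm_section (g : T1 * T2 -> \bar R) (p : R) :
  (0 < p)%R -> measurable_fun setT g ->
  measurable_fun setT (fun x => weakLnorm m2 p (fun y => g (x, y))).
Proof.
move=> p0 mg; apply: measurable_fun_lt_levels => r.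
pose B (q : R) := [set z | q%:E < `|g z|].
have mB q : measurable (B q).
  rewrite -[B q]setTI; apply: emeasurable_fun_o_infty => //.
  exact: measurableT_comp.
have xB q x : [set y | q%:E < `|g (x, y)|] = xsection (B q) x.
  by apply/seteqP; split => y; rewrite /xsection/= inE.
have mxB q x : measurable (xsection (B q) x) by exact: measurable_xsection.
rewrite [X in measurable X](_ : _ = \bigcup_q
    [set x | (0 < ratr q :> R)%R /\
      r%:E < (ratr q)%:E * (m2 (xsection (B (ratr q)) x)) `^ p^-1]).
  apply: bigcupT_measurable_rat => q.
  have [q0|q0] := ltP 0%R (ratr q : R); last first.
    rewrite (_ : [set _ | _] = set0)//.
    by apply/seteqP; split => x //= [].
  rewrite (_ : [set _ | _] = [set x |
      r%:E < (ratr q)%:E * (m2 (xsection (B (ratr q)) x)) `^ p^-1]); last first.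
    by apply/seteqP; split => x /=; [case|].
  rewrite -[X in measurable X]setTI; apply: emeasurable_fun_o_infty => //.
  apply: measurable_funeM; apply: (measurableT_comp (measurable_poweR _)).
  exact: measurable_fun_xsection.
apply/seteqP; split => x /=; last first.
  move=> [q _ [q0 rq]]; apply: lt_le_trans rq _.
  by rewrite -xB; exact: weakLnorm_ubound.
move=> /ereal_sup_gt [_ [l /= l0 <-]]; rewrite xB => rl.
have [q lq rq] : exists2 q : rat, (0 < (ratr q : R) < l)%R &
    r%:E < (ratr q)%:E * m2 (xsection (B l) x) `^ p^-1.
  move: rl; set M := _ `^ _; have : 0 <= M by exact: poweR_ge0.
  case: M => [M|_ _|//].
    rewrite lee_fin le_eqVlt => /predU1P[<-|M0].
      rewrite mule0 lte_fin => r0.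
      have /rat_in_itvoo[q] := l0; rewrite in_itv/= => ql.
      by exists q => //; rewrite mule0 lte_fin.
    rewrite -EFinM lte_fin -ltr_pdivrMr// => rl.
    have /rat_in_itvoo[q] : (Num.max 0 (r / M) < l)%R by rewrite gt_max l0.
    rewrite in_itv/= gt_max => /andP[/andP[q0 rq] ql].
    by exists q; rewrite ?q0// -EFinM lte_fin -ltr_pdivrMr.
  have /rat_in_itvoo[q] := l0; rewrite in_itv/= => /andP[q0 ql].
  by exists q; rewrite ?q0// gt0_muley ?lte_fin// ltry.
have /andP[q0 ql] := lq.
exists q => //; split => //; apply: lt_le_trans rq _.
rewrite lee_pmul2l ?lte_fin//.
apply: gt0_ler_poweR; [by rewrite invr_ge0 ltW|
  by rewrite in_itv/= measure_ge0 leey|by rewrite in_itv/= measure_ge0 leey|].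
apply: le_measure; rewrite ?inE// -!xB => y/=.
by apply: le_lt_trans; rewrite lee_fin ltW.
Qed.

End measurable_weakLnorm.

(** * Hoelder's inequality on sets of finite measure *)

(** If u were larger than the sum of the layers, then each layer k that u
    exceeds would put u above s * 2 ^ k.+1 as well, so u would exceed every
    layer and the sum would be infinite. *)
Lemma le_dyadic_layers (R : realType) (s : R) (u : \bar R) : (0 < s)%R ->
  u <= s%:E + \sum_(0 <= k <oo)
    (s * 2 ^+ k.+1)%:E * (((s * 2 ^+ k)%:E < u)%E%:R)%:E.
Proof.
move=> s0; pose t k := (s * 2 ^+ k.+1)%:E * (((s * 2 ^+ k)%:E < u)%E%:R)%:E.
set S := \sum_(0 <= k <oo) _.
have SE : S = \sum_(0 <= k <oo) t k by [].
have t0 k : 0 <= t k.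
  by rewrite mule_ge0 ?lee_fin// mulr_ge0 ?exprn_ge0 ?ltW.
have tS k : t k <= S.
  rewrite SE (@nneseriesD1 _ t k)//.
  by rewrite leeDl// nneseries_ge0// => *; exact: t0.
have S0 : 0 <= S by exact: le_trans (t0 0%N) (tS 0%N).
have [us|su] := leP u s%:E; first by rewrite (le_trans us)// leeDl.
apply: (@le_trans _ _ S); last by rewrite leeDr// lee_fin ltW.
rewrite leNgt; apply/negP => Su.
have su2 k : (s * 2 ^+ k)%:E < u.
  elim: k => [|k IH]; first by rewrite expr0 mulr1.
  by apply: le_lt_trans Su; have := tS k; rewrite /t IH mule1.
have sS k : (s * 2 ^+ k.+1)%:E <= S by have := tS k; rewrite /t su2 mule1.
have Sfin : S \is a fin_num.
  by rewrite ge0_fin_numE//; apply: lt_le_trans Su (leey _).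
have := sS (Num.truncn (fine S / s)).
rewrite -[leRHS]fineK// lee_fin -ler_pdivlMl// leNgt => /negP; apply.
rewrite mulrC (lt_trans (truncnS_gt _))// -natrX ltr_nat.
exact: ltn_expl.
Qed.

(** The part of h below the first dyadic height contributes 1, the layers
    above it a geometric series of ratio 2 ^ (1 - p). *)
Definition holder_const (R : realType) (p : R) : R :=
  (1 + 2 / (1 - 2 / 2 `^ p))%R.

Lemma holder_ratio_lt1 (R : realType) (p : R) :
  (1 < p)%R -> (2 / 2 `^ p < 1 :> R)%R.
Proof.
move=> p1; rewrite ltr_pdivrMr ?powR_gt0// mul1r.
rewrite -mulr_powRB1 ?(lt_trans _ p1)// ltr_pMr//.
suff : (1 `^ (p - 1) < 2 `^ (p - 1) :> R)%R by rewrite powR1.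
by apply: gt0_ltr_powR; rewrite ?nnegrE ?subr_gt0// ltr1n.
Qed.

Lemma holder_const_gt0 (R : realType) (p : R) :
  (1 < p)%R -> (0 < holder_const p)%R.
Proof.
by move=> p1; rewrite addr_gt0// divr_gt0// subr_gt0 holder_ratio_lt1.
Qed.

Section weak_holder.
Context d (T : measurableType d) (R : realType).
Variables (m : {measure set T -> \bar R}) (p : R) (E : set T) (a : R).
Hypotheses (p1 : (1 < p)%R) (mE : measurable E).
Hypotheses (Ea : m E = a%:E) (a0 : (0 < a)%R).
Variable h : T -> \bar R.
Hypotheses (mh : measurable_fun setT h) (h0 : forall y, 0 <= h y).

Let p0 : (0 < p)%R. Proof. exact: lt_trans p1. Qed.

Let mB (l : R) : measurable [set y | l%:E < h y].
Proof.
by rewrite -[X in measurable X]setTI; exact: emeasurable_fun_o_infty.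
Qed.

Let weak_holder_pos (w : R) : (0 < w)%R -> weakLnorm m p h <= w%:E ->
  \int[m]_(y in E) h y <= (holder_const p * a `^ (1 - p^-1) * w)%:E.
Proof.
move=> w0 /weakLnorm_leP hw.
have {}hw (l : R) : (0 < l)%R -> m [set y | l%:E < h y] <= ((w / l) `^ p)%:E.
  move=> l0; have := hw p0 (ltW w0) _ l l0.
  under eq_set do rewrite gee0_abs//.
  by apply=> ? _; exact: measure_ge0.
(* At height s the weak-type bound (w / s) ^ p is the full measure a of E. *)
pose s : R := (w / a `^ p^-1)%R.
have s0 : (0 < s)%R by rewrite divr_gt0// powR_gt0.
pose B k := [set y | (s * 2 ^+ k)%:E < h y].
have sk0 k : (0 <= s * 2 ^+ k)%R by rewrite mulr_ge0 ?exprn_ge0// ltW.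
have m1 k : measurable_fun E (fun y => (\1_(B k) y)%:E).
  by apply/measurable_EFinP; apply: measurable_indic; exact: mB.
have mt k : measurable_fun E (fun y => (s * 2 ^+ k.+1)%:E * (\1_(B k) y)%:E).
  exact: measurable_funeM.
have t0 k y : 0 <= (s * 2 ^+ k.+1)%:E * (\1_(B k) y)%:E.
  by rewrite mule_ge0 ?lee_fin.
apply: (@le_trans _ _ (\int[m]_(y in E) (s%:E + \sum_(0 <= k <oo)
    (s * 2 ^+ k.+1)%:E * (\1_(B k) y)%:E))).
  apply: ge0_le_integral => //.
  - exact: measurable_funTS.
  - apply: emeasurable_funD => //; apply: ge0_emeasurable_sum => [k y _ _|k _].
      exact: t0.
    exact: mt.
  - move=> y _; under eq_eseriesr do rewrite indicE mem_setE.
    exact: le_dyadic_layers.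
rewrite ge0_integralD//; last 3 first.
- by move=> y _; rewrite lee_fin ltW.
- by move=> y _; apply: nneseries_ge0 => k *; exact: t0.
- by apply: ge0_emeasurable_sum => k *; [exact: t0|exact: mt].
rewrite integral_cst// integral_nneseries//.
pose r : R := (2 / 2 `^ p)%R.
have r1 : (r < 1)%R by exact: holder_ratio_lt1.
have r0 : (0 < r)%R by rewrite divr_gt0// powR_gt0.
have layer k : \int[m]_(y in E) ((s * 2 ^+ k.+1)%:E * (\1_(B k) y)%:E) <=
    (geometric (2 * (s * a)) r k)%:E.
  rewrite ge0_integralZl//; last by rewrite lee_fin.
  rewrite integral_indic//; last exact: mB.
  apply: (@le_trans _ _ ((s * 2 ^+ k.+1)%:E * ((w / (s * 2 ^+ k)) `^ p)%:E)).
    apply: lee_pmul => //; rewrite ?lee_fin//.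
    apply: (@le_trans _ _ (m (B k))).
      by apply: le_measure; rewrite ?inE//; [apply: measurableI => //|]; exact: mB.
    by apply: hw; rewrite mulr_gt0// exprn_gt0.
  rewrite -EFinM lee_fin.
  have -> : ((w / (s * 2 ^+ k)) `^ p = a / (2 `^ p) ^+ k)%R.
    have -> : (w / (s * 2 ^+ k) = a `^ p^-1 * (2 ^+ k)^-1)%R.
      by rewrite /s; field; rewrite ?gt_eqF ?powR_gt0 ?exprn_gt0.
    rewrite powRM ?powR_ge0 ?invr_ge0 ?exprn_ge0// -powRrM mulVf ?gt_eqF//.
    rewrite powRr1 ?ltW//; congr (_ * _)%R.
    rewrite -powR_inv1 ?exprn_ge0// powRAC powR_inv1 ?powR_ge0//.
    by rewrite -(powR_mulrn k (ler0n R 2)) -(powR_mulrn k (powR_ge0 2 p)) powRAC.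
  rewrite /geometric/= /r expr_div_n exprS le_eqVlt; apply/orP; left; apply/eqP.
  by field; rewrite expf_neq0// gt_eqF// powR_gt0.
rewrite Ea; apply: (@le_trans _ _ (s%:E * a%:E + (2 * (s * a) / (1 - r))%:E)).
  apply: leeD2l; apply: lime_le.
    by apply: is_cvg_nneseries => k *; apply: integral_ge0.
  apply: nearW => n.
  apply: (@le_trans _ _ (\sum_(0 <= k < n) (geometric (2 * (s * a)) r k)%:E)).
    by apply: lee_sum => k _; exact: layer.
  rewrite sumEFin lee_fin; apply: geometric_le_lim => //.
    by apply: mulr_ge0 => //; apply: mulr_ge0; exact: ltW.
  by rewrite ger0_norm// ltW.
rewrite -EFinM -EFinD lee_fin le_eqVlt; apply/orP; left; apply/eqP.
have -> : (a `^ (1 - p^-1) = a / a `^ p^-1)%R.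
  by rewrite powRB ?powRr1 ?(ltW a0)// (gt_eqF a0) implybT.
rewrite /holder_const /s -/r; field.
by rewrite ?subr_eq0 ?gt_eqF ?powR_gt0.
Qed.

(** Cut h at the dyadic heights s * 2 ^ k. Below s, the integral over E is
    at most s * a; layer k contributes at most s * 2 ^ k.+1 times the
    measure (w / (s * 2 ^ k)) ^ p of the superlevel set, where w is the
    quasi-norm. *)
Lemma weak_holder :
  \int[m]_(y in E) h y <=
  (holder_const p * a `^ (1 - p^-1))%:E * weakLnorm m p h.
Proof.
set c : R := (_ * _)%R.
have c0 : (0 < c)%R by rewrite mulr_gt0 ?holder_const_gt0 ?powR_gt0.
have := weakLnorm_ge0 m p h; have := @weak_holder_pos.
case: (weakLnorm m p h) => [w|_ _|//]; last by rewrite gt0_muley ?lte_fin// leey.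
rewrite lee_fin => hw w0; apply/lee_addgt0Pr => e e0.
(* The dyadic heights are multiples of the quasi-norm, which may vanish; hence
   the perturbation. *)
have ec : (0 < e / c)%R by rewrite divr_gt0.
apply: (le_trans (hw (w + e / c)%R _ _)).
- by rewrite ltr_wpDl.
- by rewrite lee_fin lerDl ltW.
- by rewrite -/c mulrDr EFinD EFinM [(c * (e / c))%R]mulrC mulfVK// gt_eqF.
Qed.

End weak_holder.

(** * The inequality for product-measurable functions *)

Section weak_minkowski.
Context d1 d2 (T1 : measurableType d1) (T2 : measurableType d2) (R : realType).
Variables (m1 : {sigma_finite_measure set T1 -> \bar R}).
Variables (m2 : {sigma_finite_measure set T2 -> \bar R}).
Variable g : T1 * T2 -> \bar R.
Hypotheses (mg : measurable_fun setT g) (g0 : forall z, 0 <= g z).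

(** Tonelli's theorem, applied to g cut off outside the strip above E. *)
Lemma exchange_integral_on (E : set T2) : measurable E ->
  \int[m2]_(y in E) \int[m1]_x g (x, y) = \int[m1]_x \int[m2]_(y in E) g (x, y).
Proof.
move=> mE; pose gE := g \_ (setT `*` E).
have mgE : measurable_fun setT gE.
  apply/(measurable_restrictT _ _).1; first exact: measurableX.
  exact: measurable_funTS.
have gE0 z : 0 <= gE z by apply: erestrict_ge0.
have gEE x y : gE (x, y) = if y \in E then g (x, y) else 0.
  by rewrite /gE patchE in_setX in_setT.
have -> : \int[m2]_(y in E) \int[m1]_x g (x, y) = \int[m2]_y \int[m1]_x gE (x, y).
  rewrite integral_mkcond; apply: eq_integral => y _; rewrite patchE.
  under [RHS]eq_integral do rewrite gEE.
  by case: ifP => // _; rewrite integral0.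
rewrite -(fubini_tonelli gE)//; apply: eq_integral => x _.
rewrite /fubini_F [RHS]integral_mkcond; apply: eq_integral => y _.
by rewrite gEE patchE.
Qed.

Variables (p : R) (p1 : (1 < p)%R).
Let p0 : (0 < p)%R. Proof. exact: lt_trans p1. Qed.
Let G y := \int[m1]_x g (x, y).
Let W x := weakLnorm m2 p (fun y => g (x, y)).

Let mG : measurable_fun setT G.
Proof. exact: measurable_fun_fubini_tonelli_G. Qed.

Let G0 y : 0 <= G y. Proof. exact: integral_ge0. Qed.

Let weak_minkowski_on (E : set T2) (l J : R) : measurable E -> m2 E < +oo ->
  (forall y, E y -> l%:E < G y) -> (0 < l)%R -> \int[m1]_x W x = J%:E ->
  l%:E * m2 E `^ p^-1 <= (holder_const p * J)%:E.
Proof.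
move=> mE Efin EG l0 IJ.
have J0 : (0 <= J)%R.
  by rewrite -lee_fin -IJ; apply: integral_ge0 => x _; exact: weakLnorm_ge0.
have [a Ea] : exists a, m2 E = a%:E.
  by exists (fine (m2 E)); rewrite fineK// ge0_fin_numE.
have : (0 <= a)%R by rewrite -lee_fin -Ea.
rewrite Ea le_eqVlt => /predU1P[<-|a0].
  rewrite poweR0r ?invr_neq0 ?gt_eqF// mule0 lee_fin mulr_ge0//.
  exact/ltW/holder_const_gt0.
pose c : R := (holder_const p * a `^ (1 - p^-1))%R.
have c0 : (0 < c)%R by rewrite mulr_gt0 ?holder_const_gt0 ?powR_gt0.
have : l%:E * a%:E <= c%:E * J%:E.
  rewrite -Ea -integral_cst// -IJ -ge0_integralZl//; last 3 first.
  - exact: measurable_weakLnorm_section.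
  - by move=> x _; exact: weakLnorm_ge0.
  - by rewrite lee_fin ltW.
  apply: (@le_trans _ _ (\int[m2]_(y in E) G y)).
    apply: ge0_le_integral => //.
    - by move=> y _; rewrite lee_fin ltW.
    - exact: measurable_funTS.
    - by move=> y Ey; exact/ltW/EG.
  rewrite exchange_integral_on//; apply: ge0_le_lower_integral => x.
    exact: integral_ge0.
  by apply: weak_holder => //; exact: measurableT_comp mg (measurable_pair1 x).
rewrite poweR_EFin -!EFinM !lee_fin /c.
have ap0 : (0 < a `^ p^-1)%R by exact: powR_gt0.
have -> : (a `^ (1 - p^-1) = a / a `^ p^-1)%R.
  by rewrite powRB ?powRr1 ?(ltW a0)// (gt_eqF a0) implybT.
have -> : (holder_const p * (a / a `^ p^-1) * J =
           holder_const p * J / a `^ p^-1 * a)%R.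
  by field; rewrite gt_eqF.
by rewrite ler_pM2r// ler_pdivlMr.
Qed.

(** Duality by hand: on the superlevel set E of the integral, Chebyshev's
    inequality, Tonelli's theorem and [weak_holder] bound l * m2 E by a
    multiple of (m2 E)^(1 - 1/p); one divides by that power, which is
    legitimate after E is cut down to finite measure. *)
Lemma weak_minkowski : weakLnorm m2 p G <= (holder_const p)%:E * \int[m1]_x W x.
Proof.
have C0 := holder_const_gt0 p1.
have : 0 <= \int[m1]_x W x.
  by apply: integral_ge0 => x _; exact: weakLnorm_ge0.
move IJ : (\int[m1]_x W x) => I; case: I IJ => [J IJ|_ _|//]; last first.
  by rewrite gt0_muley ?lte_fin// leey.
rewrite lee_fin => J0; rewrite -EFinM.
apply/weakLnorm_leP => //; first by rewrite mulr_ge0// ltW.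
move=> l l0.
have /sigma_finiteP[F [TF ndF Foo]] := sigma_finiteT m2.
pose E := [set y | l%:E < `|G y|].
have mE : measurable E.
  rewrite -[E]setTI; apply: emeasurable_fun_o_infty => //.
  exact: measurableT_comp.
pose EF k := E `&` F k.
have mEF k : measurable (EF k) by apply: measurableI => //; have [] := Foo k.
have EFE : \bigcup_k EF k = E by rewrite /EF -setI_bigcupr -TF setIT.
have ndEF : {homo EF : n k / (n <= k)%N >-> (n <= k)%O}.
  by move=> n k nk; apply/subsetPset; apply: setIS; apply/subsetPset; exact: ndF.
have mbig : measurable (\bigcup_k EF k) by rewrite EFE.
have := nondecreasing_cvg_mu mEF mbig ndEF (mu := m2); rewrite EFE => cv.
rewrite -/E -(cvg_lim _ cv)//; apply: lime_le; first by apply/cvg_ex; exists (m2 E).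
apply: nearW => k /=.
rewrite -lee_mul_poweRV ?measure_ge0// ?mulr_ge0 ?(ltW C0)//.
apply: weak_minkowski_on => //.
- apply: le_lt_trans (Foo k).2; apply: le_measure; rewrite ?inE//.
  + by have [] := Foo k.
  + exact: subIsetr.
- by move=> y [+ _]; rewrite /E/= gee0_abs.
Qed.

End weak_minkowski.

(** * Functions measurable for a completed measure *)

Lemma ereal_rat_between (R : realType) (a b : \bar R) : a < b ->
  exists q : rat, a < (ratr q)%:E < b.
Proof.
have itv (r s : R) : (r < s)%R -> exists q : rat, (r < ratr q < s)%R.
  by move=> /rat_in_itvoo[q]; rewrite in_itv/= => qrs; exists q.
case: a b => [a| |] [b| |]//.
- by rewrite lte_fin => /itv[q]; exists q; rewrite !lte_fin.
- move=> _; have [q /andP[aq _]] := itv a (a + 1)%R (ltr_pwDr ltr01 (lexx a)).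
  by exists q; rewrite lte_fin aq ltry.
- move=> _; have [|q /andP[_ qb]] := itv (b - 1)%R b; first by rewrite ltrBlDr ltrDl.
  by exists q; rewrite ltNyr lte_fin.
- by move=> _; exists 0%R; rewrite ltNyr ltry.
Qed.

Section measurable_hull.
Context d (T : measurableType d) (R : realType).
Variable mu : {measure set T -> \bar R}.
Local Notation "mu ^*" := (mu_ext mu).

(** Intersect countable covers whose total measure approaches the infimum that
    defines the outer measure. *)
Lemma mu_ext_hull (X : set T) :
  exists B, [/\ measurable B, X `<=` B & mu B = mu^* X].
Proof.
have [Xoo|Xfin] := eqVneq (mu^* X) +oo.
  exists setT; split => //; apply/eqP.
  by rewrite Xoo -leye_eq -Xoo -(measurable_mu_extE mu)//; exact: le_mu_ext.
have {}Xfin : mu^* X \is a fin_num.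
  by rewrite ge0_fin_numE ?ltey//; exact: mu_ext_ge0.
have cover (k : nat) : exists B, [/\ measurable B, X `<=` B &
    mu B <= mu^* X + k.+1%:R^-1%:E].
  have k0 : (0 < k.+1%:R^-1 :> R)%R by rewrite invr_gt0.
  have [_ [F [mF XF] <-] Fk] := lb_ereal_inf_adherent k0 Xfin.
  exists (\bigcup_i F i); split => //; first exact: bigcupT_measurable.
  apply: le_trans (ltW Fk).
  by apply: measure_sigma_subadditive => //; exact: bigcupT_measurable.
have [B_ B_P] := choice cover.
have mB : measurable (\bigcap_k B_ k).
  by apply: bigcapT_measurable => k; have [] := B_P k.
have XB : X `<=` \bigcap_k B_ k.
  by move=> x Xx k _; have [_ + _] := B_P k; exact.
exists (\bigcap_k B_ k); split => //; apply/eqP; rewrite eq_le; apply/andP; split.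
  apply/lee_addgt0Pr => e e0.
  have [k ke] : exists k : nat, (k.+1%:R^-1 < e)%R.
    exists (Num.truncn e^-1); rewrite invf_plt ?posrE//; exact: truncnS_gt.
  have [mBk _ Bk] := B_P k.
  apply: (@le_trans _ _ (mu (B_ k))).
    by apply: le_measure; rewrite ?inE//; exact: bigcap_inf.
  by rewrite (le_trans Bk)// leeD2l// lee_fin ltW.
by rewrite -(measurable_mu_extE mu mB); exact: le_mu_ext.
Qed.

Lemma mu_ext0_negligible (X : set T) : mu^* X = 0 -> mu.-negligible X.
Proof. by have [B [mB XB <-]] := mu_ext_hull X => B0; exists B. Qed.

(** A hull of A overshoots it by an outer-null set when A has finite
    measure, by the Caratheodory splitting of the hull along A. *)
Let caratheodory_hull_finite (A : set T) : mu^*.-caratheodory A ->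
  mu^* A < +oo ->
  exists B, [/\ measurable B, A `<=` B & mu.-negligible (B `\` A)].
Proof.
move=> cA Afin; have [B [mB AB muB]] := mu_ext_hull A.
exists B; split => //; apply: mu_ext0_negligible.
have Af : mu^* A \is a fin_num by rewrite ge0_fin_numE//; exact: mu_ext_ge0.
have := cA B; rewrite /= (measurable_mu_extE mu mB) muB (setIidr AB) -setDE => H.
by rewrite -(addeK (mu^* (B `\` A)) Af) addeC [in X in _ + X]addeC -H addeC subee.
Qed.

(** Sigma-finiteness reduces to the finite case: a union of hulls of the pieces
    of A is a hull of A. *)
Lemma caratheodory_hull (A : set T) : sigma_finite setT mu ->
  mu^*.-caratheodory A ->
  exists B, [/\ measurable B, A `<=` B & mu.-negligible (B `\` A)].
Proof.
move=> [F TF mF] cA.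
have hull k : exists B, [/\ measurable B, A `&` F k `<=` B &
    mu.-negligible (B `\` (A `&` F k))].
  have [mFk Fk] := mF k.
  apply: caratheodory_hull_finite.
    apply: (@caratheodory_measurable_setI _ _ (mu_ext mu)) => //.
    exact: caratheodory_measurable_mu_ext.
  apply: le_lt_trans Fk; rewrite -(measurable_mu_extE mu mFk).
  by apply: le_mu_ext; exact: subIsetr.
have [B_ B_P] := choice hull.
exists (\bigcup_k B_ k); split.
- by apply: bigcupT_measurable => k; have [] := B_P k.
- move=> x Ax; have [k _ Fx] : (\bigcup_k F k) x by rewrite -TF.
  by exists k => //; have [_ + _] := B_P k; apply.
- apply: (@negligibleS _ _ _ mu (\bigcup_k (B_ k `\` (A `&` F k)))).
    by move=> x [[k _ Bx] nAx]; exists k => //; split => // -[].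
  by apply: negligible_bigcup => k; have [] := B_P k.
Qed.

End measurable_hull.

Section completion.
Context d (T : measurableType d) (R : realType).
Variable mu : {measure set T -> \bar R}.
Local Notation cT := (caratheodory_type (mu_ext mu)).
Local Notation cmu := (@completed_measure_extension _ _ _ mu).

(** The majorant is the supremum of the rational levels q over measurable hulls
    of the superlevel sets of f; it exceeds f only where one of countably many
    hulls exceeds its superlevel set. *)
Lemma measurable_majorant (f : cT -> \bar R) : sigma_finite setT mu ->
  measurable_fun setT f ->
  exists g : T -> \bar R, [/\ measurable_fun setT g, (forall z, f z <= g z) &
    mu.-negligible [set z | f z < g z]].
Proof.
move=> sf mf.
pose A (q : rat) : set T := [set z | (ratr q)%:E < f z].
have cA q : (mu_ext mu).-caratheodory (A q).
  suff : measurable ([set: cT] `&` A q) by rewrite setTI.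
  exact: emeasurable_fun_o_infty.
have [B B_P] := choice (fun q => caratheodory_hull sf (cA q)).
pose L z := [set (ratr q : R)%:E | q in [set q | B q z]].
exists (fun z => ereal_sup (L z)); split.
- apply: measurable_fun_lt_levels => r.
  rewrite (_ : [set _ | _] = \bigcup_(q : rat)
      (if (r < ratr q)%R then B q else set0)); last first.
    apply/seteqP; split => [z /= /ereal_sup_gt[_ [q /= Bq <-]]|z [q _ /=]].
      by rewrite lte_fin => rq; exists q => //; rewrite rq.
    case: ifPn => // rq Bq; apply: (@lt_le_trans _ _ (ratr q)%:E).
      by rewrite lte_fin.
    by apply: ereal_sup_ubound; exists q.
  apply: bigcupT_measurable_rat => q; case: ifP => // _.
  by have [] := B_P q.
- move=> z; rewrite leNgt; apply/negP => Lf.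
  have [q /andP[Lq qf]] := ereal_rat_between Lf.
  suff : (ratr q)%:E <= ereal_sup (L z) by rewrite leNgt Lq.
  apply: ereal_sup_ubound; exists q => //=.
  by have [_ + _] := B_P q; apply.
- pose N (o : option rat) := oapp (fun q => B q `\` A q) set0 o.
  apply: (@negligibleS _ _ _ mu (\bigcup_k N (unpickle k))).
    move=> z /ereal_sup_gt[_ [q Bq <-]] fq.
    exists (pickle q); first exact: Logic.I.
    by rewrite pickleK; split => // /(lt_trans fq); rewrite ltxx.
  apply: negligible_bigcup => k; case: unpickle => [q|].
    by have [] := B_P q.
  exact: negligible_set0.
Qed.

(** The identity from the completed space to the original one is measurable and
    pushes the completed measure to the original one. *)
Lemma integral_completed (h : T -> \bar R) :
  measurable_fun setT h -> (forall x, 0 <= h x) ->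
  \int[cmu]_x h x = \int[mu]_x h x.
Proof.
move=> mh h0; pose i : cT -> T := id.
have mi : measurable_fun setT i.
  by move=> _ Y mY; rewrite setTI; exact: caratheodory_measurable_mu_ext.
transitivity (\int[pushforward cmu i]_x h x).
  by rewrite ge0_integral_pushforward.
apply: eq_measure_integral => A mA _.
exact: measurable_mu_extE.
Qed.

End completion.

(** * The inequality for the completed product measure *)

Lemma sigma_finite_product d1 d2 (T1 : measurableType d1)
    (T2 : measurableType d2) (R : realType)
    (m1 : {sigma_finite_measure set T1 -> \bar R})
    (m2 : {sigma_finite_measure set T2 -> \bar R}) :
  sigma_finite setT (m1 \x m2).
Proof.
have /sigma_finiteP[F [TF ndF Foo]] := sigma_finiteT m1.
have /sigma_finiteP[G [TG ndG Goo]] := sigma_finiteT m2.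
exists (fun k => F k `*` G k).
  apply/esym/seteqP; split => // -[x y] _.
  have [i _ Fx] : (\bigcup_k F k) x by rewrite -TF.
  have [j _ Gy] : (\bigcup_k G k) y by rewrite -TG.
  exists (maxn i j) => //; split.
    by have /subsetPset := ndF _ _ (leq_maxl i j); exact.
  by have /subsetPset := ndG _ _ (leq_maxr i j); exact.
move=> k; have [mF Fk] := Foo k; have [mG Gk] := Goo k.
split; first exact: measurableX.
by rewrite product_measure1E// lte_mul_pinfty// ge0_fin_numE.
Qed.

(** The product measure of N is the integral of the measures of its slices. *)
Lemma negligible_xsection d1 d2 (T1 : measurableType d1)
    (T2 : measurableType d2) (R : realType)
    (m1 : {sigma_finite_measure set T1 -> \bar R})
    (m2 : {sigma_finite_measure set T2 -> \bar R}) (N : set (T1 * T2)) :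
  measurable N -> (m1 \x m2) N = 0 ->
  exists M, [/\ measurable M, m1 M = 0 &
    forall x, ~ M x -> m2 (xsection N x) = 0].
Proof.
move=> mN N0.
have mxN : measurable_fun setT (m2 \o xsection N).
  exact: measurable_fun_xsection.
have : ae_eq m1 setT (m2 \o xsection N) (cst 0).
  apply/(ae_eq_integral_abs m1 measurableT mxN).
  by rewrite -[RHS]N0; apply: eq_integral => x _; rewrite gee0_abs//=.
case=> M [mM M0 HM]; exists M; split => // x nMx.
by apply: contrapT => Nx; apply: nMx; apply: HM => /= /(_ Logic.I).
Qed.

Section weak_minkowski_completed.
Context d (T : measurableType d) (R : realType).
Variable m : {sigma_finite_measure set T -> \bar R}.
Variables (p : R) (p1 : (1 < p)%R).
Local Notation cT := (caratheodory_type (mu_ext m)).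
Local Notation cm := (@completed_measure_extension _ _ _ m).
Let p0 : (0 < p)%R. Proof. exact: lt_trans p1. Qed.

(** The left-hand side grows when f is replaced by its majorant g. On the
    right, the exceptional null set M is removed from the integral for g,
    and outside M the level sets of g(x, .) exceed those of f(x, .) by null
    sets. *)
Lemma weak_minkowski_completed (f : caratheodory_type (mu_ext (m \x m)) -> \bar R) :
  measurable_fun setT f -> (forall z, 0 <= f z) ->
  weakLnorm cm p (fun y => \int[cm]_x `|f (x, y)|) <=
  (holder_const p)%:E * \int[cm]_x weakLnorm cm p (fun y => f (x, y)).
Proof.
move=> mf f0.
have [g [mg fg [N [mN N0 gfN]]]] := measurable_majorant (sigma_finite_product m m) mf.
have g0 z : 0 <= g z by exact: le_trans (f0 z) (fg z).
have [M [mM M0 MN]] := negligible_xsection mN N0.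
have mgx x : measurable_fun setT (fun y => g (x, y)).
  exact: measurableT_comp mg (measurable_pair1 x).
have mgy y : measurable_fun setT (fun x => g (x, y)).
  exact: measurableT_comp mg (measurable_pair2 y).
have mlev (h : T -> \bar R) (l : R) : measurable_fun setT h ->
    measurable [set y | l%:E < `|h y|].
  move=> mh; rewrite -[X in measurable X]setTI.
  by apply: emeasurable_fun_o_infty => //; exact: measurableT_comp.
apply: (@le_trans _ _ (weakLnorm m p (fun y => \int[m]_x g (x, y)))).
  apply: le_weakLnorm => // l l0; rewrite -[leRHS]measurable_mu_extE; last first.
    by apply: mlev; exact: measurable_fun_fubini_tonelli_G.
  apply: le_mu_ext => y /=; rewrite !gee0_abs; last 2 first.
  - exact: integral_ge0.
  - exact: integral_ge0.
  move=> /lt_le_trans; apply; rewrite -(integral_completed m (mgy y))//.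
  by apply: ge0_le_lower_integral => // x; rewrite gee0_abs.
apply: (le_trans (weak_minkowski m m mg g0 p1)).
rewrite lee_pmul2l ?lte_fin ?holder_const_gt0//.
pose W x := weakLnorm m p (fun y => g (x, y)).
have W0 x : 0 <= W x by exact: weakLnorm_ge0.
have mW : measurable_fun setT W by exact: measurable_weakLnorm_section.
rewrite -/W (ge0_negligible_integral mM measurableT mW (fun x _ => W0 x) M0).
rewrite integral_mkcond -integral_completed; last 2 first.
- apply/(measurable_restrictT _ _).1; first exact: measurableD.
  exact: measurable_funTS.
- by move=> x; apply: erestrict_ge0.
apply: ge0_le_lower_integral => x; first by apply: erestrict_ge0.
rewrite patchE; case: ifPn => [|_]; last exact: weakLnorm_ge0.
rewrite inE => -[_ nMx].
apply: le_weakLnorm => // l l0; rewrite -[leLHS]measurable_mu_extE; last exact: mlev.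
have sub : [set y | l%:E < `|g (x, y)|] `<=`
    [set y | l%:E < `|f (x, y)|] `|` xsection N x.
  move=> y /=; rewrite !gee0_abs// => lg.
  have [fgxy|gf] := ltP (f (x, y)) (g (x, y)).
    by right; rewrite /xsection/= inE; exact: gfN.
  by left; exact: lt_le_trans lg gf.
apply: (le_trans (le_mu_ext _ sub)).
apply: (le_trans (outer_measureU2 (mu_ext m) _ _)).
have mNx : measurable (xsection N x) by exact: measurable_xsection.
have Nx0 : mu_ext m (xsection N x) = 0.
  exact: etrans (measurable_mu_extE m mNx) (MN x nMx).
by rewrite /= Nx0 adde0.
Qed.

End weak_minkowski_completed.

Unset Implicit Arguments.

Theorem proposition6p3 (R : realType) (n : nat) (p : R) (hp : (1 < p)%R) :
  exists C : R, (0 < C)%R /\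
    forall f : lebesgue_space2 R n -> \bar R,
      (forall z, 0 <= f z) ->
      measurable_fun setT f ->
      \int[Rn_lebesgue R n]_x
        weakLnorm (Rn_lebesgue R n) p (fun y => f (x, y)) < +oo ->
      weakLnorm (Rn_lebesgue R n) p
        (fun y => \int[Rn_lebesgue R n]_x `|f (x, y)|)
      <= C%:E * \int[Rn_lebesgue R n]_x
           weakLnorm (Rn_lebesgue R n) p (fun y => f (x, y)).
Proof.
exists (holder_const p); split; first exact: holder_const_gt0.
by move=> f f0 mf _; exact: (weak_minkowski_completed hp mf f0).
Qed.
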